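(* Let $r,s,t,u\in\mathbb{R}\setminus\{0\}$ with $s=-r$ and $t=-u$. Let $\mu$ be either of the spaces $B[\mathcal{C}_f]$, $B[\mathcal{C}_{f_0}]$. Then $\mathcal{M}_u$ and $\mu$ do not contain each other, i.e. $\mathcal{M}_u\not\subset\mu$ and $\mu\not\subset\mathcal{M}_u$.
   Context: $\mathbb{N}=\{0,1,2,\dots\}$; $\Omega$ is the vector space of all complex double sequences $x=(x_{kl})_{k,l\in\mathbb{N}}$. ''$p$-$\lim$'' denotes the limit in Pringsheim's sense (both indices tend to infinity independently). $\mathcal{M}_u=\{x\in\Omega:\sup_{k,l}|x_{kl}|<\infty\}$. $[\mathcal{C}_f]$ (strongly almost convergent double sequences) is the set of $x\in\Omega$ for which there is $L\in\mathbb{C}$ with $$p\text{-}\lim_{q,q'\to\infty}\ \sup_{m,n\in\mathbb{N}}\frac{1}{(q+1)(q'+1)}\sum_{k=m}^{m+q}\sum_{l=n}^{n+q'}|x_{kl}-L|=0,$$ and $[\mathcal{C}_{f_0}]$ (strongly almost null double sequences) is the set of $x\in\Omega$ for which this holds with $L=0$. For $r,s,t,u\in\mathbb{R}\setminus\{0\}$, the generalized difference matrix $B=B(r,s,t,u)$ acts by $(Bx)_{mn}=su\,x_{m-1,n-1}+st\,x_{m-1,n}+ru\,x_{m,n-1}+rt\,x_{mn}$, where terms with a negative index are $0$. $B[\mathcal{C}_f]=\{x\in\Omega: Bx\in[\mathcal{C}_f]\}$ and $B[\mathcal{C}_{f_0}]=\{x\in\Omega: Bx\in[\mathcal{C}_{f_0}]\}$.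 *)

(* Defs.v *)
From mathcomp Require Import all_boot all_order all_algebra.
From mathcomp Require Import all_classical all_reals all_analysis.
From mathcomp Require Import complex.

Set Implicit Arguments.
Unset Strict Implicit.
Unset Printing Implicit Defensive.

Import Order.TTheory GRing.Theory Num.Theory.
Import numFieldNormedType.Exports.

Local Open Scope classical_set_scope.
Local Open Scope ring_scope.
Local Open Scope complex_scope.

Definition dseq (R : realType) : Type := nat -> nat -> R[i].

(* The norm of [R[i]] in the library takes its values in [R[i]], whereas
   [normc] is the modulus as an element of [R]. *)
Definition cmod (R : realType) (z : R[i]) : R := Normc.normc z.

(* The filter [(\oo, \oo)] is the product filter on [nat * nat]: both indices
   tend to infinity independently. *)
Definition plim (R : realType) (a : nat * nat -> \bar R) (l : \bar R) : Prop :=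
  a @ (\oo, \oo) --> l.

Definition bounded_dseq (R : realType) : set (dseq R) :=
  [set x | (ereal_sup [set (cmod (x kl.1 kl.2))%:E | kl in [set: nat * nat]]
            < +oo)%E].

Definition block_mean (R : realType) (x : dseq R) (L : R[i])
    (q q' m n : nat) : R :=
  (q.+1%:R * q'.+1%:R)^-1 *
  \sum_(m <= k < (m + q).+1) \sum_(n <= l < (n + q').+1) cmod (x k l - L).

Definition strongly_almost_converges (R : realType) (x : dseq R) (L : R[i]) :
    Prop :=
  plim (fun qq : nat * nat =>
    ereal_sup [set (block_mean x L qq.1 qq.2 mn.1 mn.2)%:E
              | mn in [set: nat * nat]]) 0%E.

Definition strongly_almost_convergent (R : realType) : set (dseq R) :=
  [set x | exists L : R[i], strongly_almost_converges x L].

Definition strongly_almost_null (R : realType) : set (dseq R) :=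
  [set x | strongly_almost_converges x 0].

(* [lag i j x m n] is x_{m-i,n-j}, and 0 when one of these indices is
   negative. *)
Definition lag (R : realType) (i j : nat) (x : dseq R) : dseq R :=
  fun m n => if (i <= m)%N && (j <= n)%N then x (m - i)%N (n - j)%N else 0.

Definition genB (R : realType) (r s t u : R) (x : dseq R) : dseq R :=
  fun m n => (s * u)%:C * lag 1 1 x m n + (s * t)%:C * lag 1 0 x m n
           + (r * u)%:C * lag 0 1 x m n + (r * t)%:C * x m n.

Definition domB (R : realType) (r s t u : R) (mu : set (dseq R)) :
    set (dseq R) :=
  [set x | mu (genB r s t u x)].

(* Main.v *)
(** The two hypotheses turn [B] into [- ru] times the mixed difference
    [x_{mn} - x_{m-1,n} - x_{m,n-1} + x_{m-1,n-1}].  The unbounded sequence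
    [x_{kl} = k] has mixed difference supported on the column [l = 0], which has
    density zero uniformly in the position of the block.  The bounded sequence
    [x_{kl} = (-1)^(k+l)] is mapped to [- 4ru (-1)^(k+l)] off the two axes;
    neighbouring entries stay [8|ru|] apart, so the means of [|Bx - L|] over a
    block and over its translate by one column cannot both be small. *)
Require Import Defs.
From mathcomp Require Import all_boot all_order all_algebra.
From mathcomp Require Import all_classical all_reals all_analysis.
From mathcomp Require Import complex.
From mathcomp Require Import ring lra.

Import Order.TTheory GRing.Theory Num.Theory.
Import numFieldNormedType.Exports.

Local Open Scope classical_set_scope.
Local Open Scope ring_scope.

Lemma cmodE (R : realType) (z : R[i]) : ((cmod z)%:C)%C = `|z|.
Proof. by case: z. Qed.

Lemma cmod_ge0 (R : realType) (z : R[i]) : 0 <= cmod z.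
Proof. by case: z => a b; exact: sqrtr_ge0. Qed.

Lemma cmodR (R : realType) (a : R) : cmod (a%:C)%C = `|a|.
Proof. by rewrite /cmod /= expr0n /= addr0 sqrtr_sqr. Qed.

Lemma cmodM (R : realType) (x y : R[i]) : cmod (x * y) = cmod x * cmod y.
Proof. exact: Normc.normcM. Qed.

Lemma ler_cmodB (R : realType) (x y : R[i]) : cmod (x - y) <= cmod x + cmod y.
Proof. by rewrite -lecR rmorphD /= !cmodE ler_normB. Qed.

Lemma cmod_sign (R : realType) (n : nat) : cmod ((-1) ^+ n : R[i]) = 1.
Proof.
by apply: (@complexI R); rewrite cmodE normrX normrN normr1 expr1n.
Qed.

Lemma genB_diff (R : realType) (r u : R) (x : dseq R) (m n : nat) :
  genB r (- r) (- u) u x m n =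
  ((- (r * u))%:C)%C *
    (x m n - lag 1 0 x m n - lag 0 1 x m n + lag 1 1 x m n).
Proof. rewrite /genB !rmorphM !rmorphN !rmorphM /=; ring. Qed.

(** On the column [l = 0] the lagged terms in [l] take the default value 0, which leaves
    [k - (k - 1) = 1]; the corner gives 0 because the sequence vanishes on the row [k = 0]. *)
Lemma genB_rowindex (R : realType) (r u : R) (k l : nat) :
  genB r (- r) (- u) u (fun k _ => k%:R) k l =
  ((- (r * u))%:C)%C * ((0 < k)%N && (l == 0)%N)%:R.
Proof.
rewrite genB_diff /lag; congr (_ * _); case: k l => [|k] [|l] /=;
  rewrite ?subn0 ?subn1 /= -?natr1; ring.
Qed.

(** Off the axes no lag falls back on 0, and the four signed terms of the mixed difference all equal
    [(-1) ^+ (k + l)]. *)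
Lemma genB_checkerboard (R : realType) (r u : R) (k l : nat) :
  genB r (- r) (- u) u (fun k l => (-1) ^+ (k + l)) k.+1 l.+1 =
  ((- (4 * (r * u)))%:C)%C * (-1) ^+ (k + l).
Proof.
rewrite genB_diff /lag /= ?subn0 ?subn1 /= !addSn !addnS !exprS.
rewrite !rmorphN !rmorphM !rmorph_nat; ring.
Qed.

(** Each of the [q + 1] rows of a block meets the column [l = 0] at most once, so every block mean
    is at most [c / (q' + 1)], wherever the block lies. *)
Lemma strongly_almost_null_column (R : realType) (c : R) (x : dseq R) :
  (forall k l, cmod (x k l) <= if l == 0%N then c else 0) ->
  strongly_almost_null x.
Proof.
move=> xc; have c0 : 0 <= c.
  by rewrite (le_trans _ (xc 0 0)%N)// cmod_ge0.
rewrite /strongly_almost_null /strongly_almost_converges /plim /=.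
apply: (@squeeze_cvge _ _ _ _ (cst 0%E) _
  (fun qq : nat * nat => (c * harmonic qq.2)%:E)).
- apply: nearW => -[q q'] /=; apply/andP; split.
    apply: le_trans (ereal_sup_ubound _); last by exists (0%N, 0%N).
    rewrite lee_fin mulr_ge0 ?invr_ge0 ?mulr_ge0//.
    by apply: sumr_ge0 => k _; apply: sumr_ge0 => l _; exact: cmod_ge0.
  apply: ge_ereal_sup => _ [[m n] _ <-] /=.
  rewrite lee_fin /block_mean /harmonic /= invfM mulrC mulrA.
  rewrite ler_wpM2r ?invr_ge0// ler_pdivrMr ?ltr0n//.
  have row k : \sum_(n <= l < (n + q').+1) cmod (x k l - 0) <= c.
    (* Starting the range at 0 makes the bound independent of [n]: the term [l = 0] is then always
       present and alone contributes. *)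
    apply: le_trans (_ : \sum_(0 <= l < (n + q').+1) (if l == 0%N then c else 0) <= _).
      rewrite (@big_cat_nat _ _ _ n 0)//=; last by rewrite -addnS leq_addr.
      apply: ler_wpDl; last by apply: ler_sum => l _; rewrite subr0.
      by apply: sumr_ge0 => l _; case: ifP.
    by rewrite big_nat_recl//= big1_eq addr0.
  apply: le_trans (ler_sum _ (fun k _ => row k)) _.
  by rewrite sumr_const_nat -addnS addKn mulr_natr.
- exact: cvg_cst.
- rewrite -[X in _ --> X](_ : (c * 0)%:E = _); last by rewrite mulr0.
  apply: cvg_EFin; first exact: nearW.
  apply: cvgM; first exact: cvg_cst.
  exact: (cvg_comp _ _ cvg_snd cvg_harmonic).
Qed.

(** Pair each entry of the block with its right neighbour in the translate: [L] cancels in the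
    difference, and the triangle inequality is averaged over the block. *)
Lemma block_mean_shift (R : realType) (d : R) (x : dseq R) (L : R[i])
    (q q' m n : nat) :
  (forall k l, (m <= k)%N -> (n <= l)%N -> d <= cmod (x k l - x k l.+1)) ->
  d <= block_mean x L q q' m n + block_mean x L q q' m n.+1.
Proof.
move=> xd; rewrite /block_mean -mulrDr ler_pdivlMl ?mulr_gt0 ?ltr0n//.
rewrite -big_split /=.
have row k : (m <= k)%N -> q'.+1%:R * d <=
    \sum_(n <= l < (n + q').+1) cmod (x k l - L) +
    \sum_(n.+1 <= l < (n.+1 + q').+1) cmod (x k l - L).
  move=> mk; rewrite big_add1 addSn /= -big_split /= mulr_natl.
  rewrite -[q'.+1 in leLHS](addKn n) addnS -sumr_const_nat.
  apply: ler_sum_nat => l /andP[nl _]; apply: le_trans (xd _ _ mk nl) _.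
  rewrite (_ : _ - x k l.+1 = (x k l - L) - (x k l.+1 - L)); first exact: ler_cmodB.
  by ring.
rewrite -mulrA mulr_natl -[q.+1 in leLHS](addKn m) addnS -sumr_const_nat.
by apply: ler_sum_nat => k /andP[mk _]; exact: row.
Qed.

Lemma oscillating_not_strongly_almost_convergent (R : realType) (d : R)
    (x : dseq R) :
  0 < d -> (forall k l, d <= cmod (x k.+1 l.+1 - x k.+1 l.+2)) ->
  ~ strongly_almost_convergent x.
Proof.
move=> d0 xd [L]; rewrite /strongly_almost_converges /plim.
set S := (X in X @ _ --> _) => SL.
suff : ((d / 2)%:E <= 0)%E by rewrite lee_fin leNgt divr_gt0.
(* The supremum is at least [d / 2] for every [q], [q']: otherwise the blocks at (1, 1) and (1, 2),
   both off the axes, would have means summing to less than [d]. *)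
apply: (cvge_to_ge SL); apply: nearW => -[q q']; rewrite leNgt; apply/negP.
rewrite /S /= => Sd.
have small n : block_mean x L q q' 1 n < d / 2.
  rewrite -lte_fin; apply: le_lt_trans Sd; apply: ereal_sup_ubound.
  by exists (1%N, n).
have := small 1%N; have := small 2%N.
have : d <= block_mean x L q q' 1 1 + block_mean x L q q' 1 2.
  by apply: block_mean_shift => -[|k] [|l].
lra.
Qed.

Theorem theorem3p3 (R : realType) (r s t u : R)
    (hr : r != 0) (hs : s != 0) (ht : t != 0) (hu : u != 0)
    (hsr : s = - r) (htu : t = - u) (mu : set (dseq R))
    (hmu : mu = domB r s t u (@strongly_almost_convergent R) \/
           mu = domB r s t u (@strongly_almost_null R)) :
  ~ (@bounded_dseq R `<=` mu) /\ ~ (mu `<=` @bounded_dseq R).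
Proof.
have ru0 : 0 < `|r * u| by rewrite normr_gt0 mulf_neq0.
(* Since [mu] lies between the two domains, the bounded example need only avoid the larger one and
   the unbounded example need only lie in the smaller one. *)
have mu_conv : mu `<=` domB r s t u (@strongly_almost_convergent R).
  by case: hmu => ->// x x0; exists 0.
have null_mu : domB r s t u (@strongly_almost_null R) `<=` mu.
  by case: hmu => ->// x x0; exists 0.
subst s t; split.
- pose x : dseq R := fun k l => (-1) ^+ (k + l).
  move=> /(_ x) bx; have /bx /mu_conv : bounded_dseq x.
    apply: le_lt_trans (ltry (1 : R)); apply: ge_ereal_sup => _ [kl _ <-].
    by rewrite cmod_sign.
  apply: (@oscillating_not_strongly_almost_convergent _ (8 * `|r * u|)).
    by rewrite mulr_gt0.
  move=> k l; rewrite !genB_checkerboard addnS exprS.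
  rewrite (_ : _ - _ = ((- (8 * (r * u)))%:C)%C * (-1) ^+ (k + l)); last first.
    rewrite !rmorphN !rmorphM !rmorph_nat; ring.
  rewrite cmodM cmodR cmod_sign mulr1 normrN (normrM 8).
  by rewrite (ger0_norm (x := 8)) ?ler0n.
- move=> /(_ (fun k _ => k%:R)) bx.
  have /null_mu /bx : domB r (- r) (- u) u (@strongly_almost_null R)
      (fun k _ => k%:R).
    apply: (@strongly_almost_null_column _ `|r * u|) => k l.
    rewrite genB_rowindex cmodM cmodR normrN -(rmorph_nat (real_complex R)) cmodR.
    by case: k l => [|k] [|l] /=; rewrite ?normr0 ?normr1 ?mulr0 ?mulr1.
  rewrite /bounded_dseq /=; set M := ereal_sup _ => Moo.
  have natM k : (k%:R%:E <= M)%E.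
    apply: ereal_sup_ubound; exists (k, 0%N) => //=.
    by rewrite -(rmorph_nat (real_complex R)) cmodR normr_nat.
  have Mfin : M \is a fin_num.
    by rewrite fin_numElt Moo andbT (lt_le_trans _ (natM 0%N))// ltNyr.
  (* Archimedean contradiction: this natural number exceeds the finite supremum [M]. *)
  have := natM (Num.truncn (fine M)).+1.
  by rewrite -(fineK Mfin) lee_fin leNgt truncnS_gt.
Qed.
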